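(* Let properties (P1)--(P15) listed in the context be fulfilled. Let $(\gamma_\ell)_{\ell\in\mathbb N}\subset(0,\infty)$ be a monotonically decreasing sequence that converges to $0$. For $\ell\in\mathbb N$, let $v^\ell\in X\cap Y$ be such that $$j(v^\ell)+\psi_{\gamma_\ell}(v^\ell)+\eta(v^\ell)\le j(w)+\psi_{\gamma_\ell}(w)+\eta(w)\quad\text{for all } w\in X\cap Z.$$ Then the sequence $(v^\ell)_{\ell\in\mathbb N}$ has a subsequence $(v^\ell)_{\ell\in L}$, $L\subset\mathbb N$, converging to some $\bar v$ with respect to the strong topology in $W$, the weak topology in $X$ and the weak$^\ast$ topology in $Y$, and $\bar v$ solves $$\min_{v\in X\cap Z}\; j(v)+\beta\|v\|_Z+\eta(v).$$
   Context: Properties: (P1) $X$ is a Hilbert space, $W$ is a separable Banach space, and the embedding $X\hookrightarrow W$ is compact. (P2) $Y$ is the dual of a separable Banach space (weak$^\ast$ convergence in $Y$ refers to this predual). (P3) The embedding $Y\hookrightarrow W$ is continuous. (P4) For each sequence $(v^k)_{k\in\mathbb N}\subset X\cap Y$ that converges weakly to $\hat v$ in $X$ and weakly$^\ast$ to $\bar v$ in $Y$, it holds that $\hat v=\bar v$ in $X\cap Y$. (P5) For each $\gamma>0$, $\psi_\gamma:Y\to\mathbb R\cup\{\infty\}$ is weakly$^\ast$ sequentially lower semicontinuous. (P6) $\eta:X\to\mathbb R$ is weakly lower semicontinuous. (P7) $j:Y\to\mathbb R$ is continuous w.r.t. the $W$-topology: if $(v^k)_{k\in\mathbb N}\subset Y$,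 $v\in Y$ and $v^k\to v$ strongly in $W$, then $j(v^k)\to j(v)$. (P8) The functions $j$, $\psi_\gamma$ ($\gamma>0$) and $\eta$ are bounded from below on $X\cap Y$. (P9) Boundedness of $(\psi_\gamma(v^k)+\eta(v^k))_{k\in\mathbb N}$ (for a sequence $(v^k)_{k\in\mathbb N}\subset X\cap Y$) implies boundedness of $(\|v^k\|_Y+\|v^k\|_X)_{k\in\mathbb N}$. (P10) $Z$ is a Banach space such that $Z\hookrightarrow Y$ (continuously). (P11) $X_k\subset X\cap Z$ ($k\in\mathbb N$) are subspaces such that $X_k\subset X_{k+1}$ for all $k$, and for all $w\in X\cap Z$ there exists a sequence $(w^k)_{k\in\mathbb N}$ with $w^k\in X_k$ such that $w^k\to w$ strongly in $X$ and $(\|w^k\|_Z)_{k\in\mathbb N}$ is bounded. (P12) For each $\gamma>0$, each bounded sequence $(v^k)_{k\in\mathbb N}\subset Z$ and $v\in Z$ such that $v^k\to v$ strongly in $W$, it follows that $\lim_{k\to\infty}\psi_\gamma(v^k)=\psi_\gamma(v)$. (P13) $\eta:X\to\mathbb R$ is strongly continuous. (P14) For each $v\in Y$, the map $(0,\infty)\ni\gamma\mapsto\psi_\gamma(v)$ is monotonically decreasing (i.e. nonincreasing). (P15) $\beta>0$ and $\psi_0:Y\to\mathbb R\cup\{\infty\}$ is such that $\psi_0(v)=\beta\|v\|_Z$ for all $v\in Z$ and $\psi_0(v)=\infty$ for all $v\in Y\setminus Z$; it holds that $\lim_{\gamma\to0^+}\psi_\gamma(v)=\psi_0(v)$ for arbitrary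 $v\in Y$. *)

(* Defs.v *)
From HB Require Import structures.
From mathcomp Require Import all_boot all_order all_algebra.
From mathcomp Require Import all_classical all_reals all_analysis.

Set Implicit Arguments.
Unset Strict Implicit.
Unset Printing Implicit Defensive.

Import Order.TTheory GRing.Theory Num.Theory.
Import numFieldNormedType.Exports.

Local Open Scope classical_set_scope.
Local Open Scope ring_scope.

Definition separable (T : topologicalType) : Prop :=
  exists2 A : set T, countable A & dense A.

(* Completeness is carried by the type; what is added is that the norm comes
   from a (real) inner product. *)
Definition hilbert (R : realType) (X : completeNormedModType R) : Prop :=
  exists ip : {dot X for (@idfun R)}, forall x : X, `|x| ^+ 2 = ip x x.

Definition continuous_embedding (R : realType) (A B : normedModType R)
    (i : {linear A -> B}) : Prop :=
  injective i /\ continuous i.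

Definition compact_embedding (R : realType) (A B : normedModType R)
    (i : {linear A -> B}) : Prop :=
  continuous_embedding i /\
  forall S : set A, bounded_set S -> precompact (i @` S).

(* The intersection of A and B, both embedded in W, as the set of pairs
   (a, b) : A * B representing one and the same element of W. *)
Definition cap (R : realType) (A B W : normedModType R)
    (iA : A -> W) (iB : B -> W) : set (A * B) :=
  [set v | iA v.1 = iB v.2].

Lemma cvg_initial_ptws (S : choiceType) (I : Type) (T : topologicalType)
    (g : S -> {ptws I -> T}) (u : nat -> S) (x : S) :
  (u : nat -> initial_topology g) @ \oo --> (x : initial_topology g) <->
  forall i, (fun n => g (u n) i) @ \oo --> g x i.
Proof.
split.
  move=> h i.
  have hg : (g \o u) @ \oo --> g x.
    exact: (cvg_comp _ _ h (@initial_continuous _ _ g x)).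
  move/cvg_sup/(_ i): hg => hi.
  exact: (cvg_comp _ _ hi (@initial_continuous _ _ (fun f : I -> T => f i) (g x))).
move=> h A /= [_ [[B Bop <-] Bgx sBA]].
apply: (filterS sBA).
have hg : (g \o u) @ \oo --> g x.
  apply/cvg_sup => i C /= [_ [[E Eop <-] Ex sEC]].
  apply: (filterS sEC).
  by apply: (h i); apply: open_nbhs_nbhs.
by apply: hg; apply: open_nbhs_nbhs.
Qed.

Section dual.
Variables (R : realType) (V : normedModType R).

Definition dual : Type :=
  {f : V -> R^o | linear f /\ continuous f}.

Definition dual_fun (f : dual) : V -> R^o := sval f.
Coercion dual_fun : dual >-> Funclass.

Definition dual_norm (f : dual) : R :=
  sup [set `|f x| | x in [set x : V | `|x| <= 1]].

(* coarsest topology on V making every element of the dual continuous *)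
Definition weak_topology : Type :=
  initial_topology ((fun x f => f x) : V -> {ptws dual -> R^o}).

HB.instance Definition _ := Topological.on weak_topology.

Definition weak_cvg (u : nat -> V) (x : V) : Prop :=
  (u : nat -> weak_topology) @ \oo --> (x : weak_topology).

Lemma weak_cvgP (u : nat -> V) (x : V) :
  weak_cvg u x <-> forall f : dual, (fun n => f (u n)) @ \oo --> f x.
Proof. exact: cvg_initial_ptws. Qed.

Definition weakly_lower_semicontinuous (f : V -> R) : Prop :=
  lower_semicontinuous (fun x : weak_topology => (f x)%:E).

End dual.

Section predual.
Variables (R : realType) (P Y : normedModType R).

(* D identifies Y, linearly and isometrically, with the dual of P. *)
Definition is_dual (D : Y -> dual P) : Prop :=
  [/\ forall p : P, linear (fun y => D y p),
      forall f : dual P, exists y, D y =1 f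
    & forall y, `|y| = dual_norm (D y)].

Variable D : Y -> dual P.

(* coarsest topology on Y making y |-> D y p continuous for every p : P *)
Definition weak_star_topology : Type :=
  initial_topology ((fun y => D y) : Y -> {ptws P -> R^o}).

HB.instance Definition _ := Topological.on weak_star_topology.

Definition weak_star_cvg (u : nat -> Y) (y : Y) : Prop :=
  (u : nat -> weak_star_topology) @ \oo --> (y : weak_star_topology).

Lemma weak_star_cvgP (u : nat -> Y) (y : Y) :
  weak_star_cvg u y <-> forall p : P, (fun n => D (u n) p) @ \oo --> D y p.
Proof. exact: cvg_initial_ptws. Qed.

Definition weak_star_seq_lsc (f : Y -> \bar R) : Prop :=
  forall (u : nat -> Y) (y : Y), weak_star_cvg u y ->
    (f y <= limn_einf (f \o u))%E.

End predual.

Definition is_minimizer (R : realType) (T : Type) (S : set T) (F : T -> R)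
    (x : T) : Prop :=
  S x /\ forall w, S w -> F x <= F w.

(* Main.v *)
(** Comparison with [w = 0] bounds [psi_(gamma_0)(v^l) + eta(v^l)], because
    [psi_gamma] increases to [psi_0] as [gamma] decreases; hence [(v^l)] is
    bounded in [X] and in [Y].  An ultrafilter gives a limit in [W] (compactness)
    and a weak* limit in [Y] (Tychonoff's argument for Banach-Alaoglu);
    separability of the predual lets one extract a single subsequence realizing
    both.  Weak convergence in [X] then comes for free, without Riesz
    representation: in a Hilbert space a decreasing sequence of closed convex
    sets that all meet a fixed ball has a common point (parallelogram law), and
    this is applied to the sets [|w - iX x| <= 1/(n+1)] cut by a closed
    half-space [a <= f x]; injectivity of [iX] identifies the common points.
    Finally, for fixed [gamma], lower semicontinuity gives
    [j y + psi_gamma y + eta x <= j w + beta |w| + eta w] along the subsequence,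
    and [gamma -> 0] shows both that [y] lies in [Z] and that it is optimal. *)

Require Import Defs.
From HB Require Import structures.
From mathcomp Require Import all_boot all_order all_algebra.
From mathcomp Require Import all_classical all_reals all_analysis.
From mathcomp Require Import ring lra.

Set Implicit Arguments.
Unset Strict Implicit.
Unset Printing Implicit Defensive.

Import Order.TTheory GRing.Theory Num.Theory.
Import numFieldNormedType.Exports.

Local Open Scope classical_set_scope.
Local Open Scope ring_scope.

(** * Weak convergence in a Hilbert space from nested closed convex sets *)

Lemma hilbert_parallelogram (R : realType) (X : completeNormedModType R) :
  hilbert X -> forall x y : X,
  `|x + y| ^+ 2 + `|x - y| ^+ 2 = 2 * (`|x| ^+ 2 + `|y| ^+ 2).
Proof.
move=> [ip ipE] x y; rewrite !ipE.
rewrite !(linearDl ip) !(linearNl ip) !(linearDr ip) !(linearNr ip).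
ring.
Qed.

(* Almost norm-minimizing points of the C n form a Cauchy sequence. *)
Lemma hilbert_bigcap_nonempty (R : realType) (X : completeNormedModType R)
    (C : nat -> set X) (M : R) : hilbert X ->
  (forall n, closed (C n)) ->
  (forall n x y, C n x -> C n y -> C n (2^-1 *: (x + y))) ->
  (forall n, C n.+1 `<=` C n) ->
  (forall n, exists2 x, C n x & `|x| <= M) ->
  exists x, forall n, C n x.
Proof.
move=> HX Ccl Cmid CS CM.
have Cle n m : (n <= m)%N -> C m `<=` C n.
  by move/subnK <-; elim: (m - n)%N => // k IH x; rewrite addSn => /CS /IH.
pose S n := [set `|x| ^+ 2 | x in C n].
pose d n := inf (S n).
have Slb n : lbound (S n) 0 by move=> _ [x _ <-]; rewrite exprn_ge0.
have Sinf n : has_inf (S n).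
  by split; [have [x Cx _] := CM n; exists (`|x| ^+ 2), x | exists 0].
have dle n x : C n x -> d n <= `|x| ^+ 2.
  by move=> Cx; apply: ge_inf; [exact: (Sinf n).2 | exists x].
have dS : {homo d : n m / (n <= m)%N >-> n <= m}.
  move=> n m nm; apply: lb_le_inf; first exact: (Sinf m).1.
  by move=> _ [x Cx <-]; apply: dle; exact: Cle Cx.
have dub : has_ubound (range d).
  exists (M ^+ 2) => _ [n _ <-]; have [x Cx xM] := CM n.
  apply: le_trans (dle _ _ Cx) _.
  by rewrite lerXn2r ?nnegrE// (le_trans _ xM).
have dcvg := nondecreasing_is_cvgn dS dub.
have dlim := nondecreasing_cvgn_le dS dcvg.
have /choice[p pP] : forall n, exists x, C n x /\ `|x| ^+ 2 < d n + n.+1%:R^-1.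
  move=> n.
  have e0 : 0 < n.+1%:R^-1 :> R by rewrite invr_gt0.
  by have [_ [x Cx <-] lt] := inf_adherent e0 (Sinf n); exists x.
(* The midpoint of [p n] and [p m] lies in [C n], so [|p n + p m| ^+ 2 >= 4 * d n]. The
   parallelogram law then leaves [2 * (d m - d n)] plus the two errors from the choice of [p], and
   [d m <= limn d]. *)
have dist n m : (n <= m)%N ->
    `|p n - p m| ^+ 2 <= 2 * (limn d - d n) + 4 * n.+1%:R^-1.
  move=> nm; have [Cn ln] := pP n; have [Cm lm] := pP m.
  have := dle _ _ (Cmid _ _ _ Cn (Cle _ _ nm _ Cm)).
  rewrite normrZ exprMn ger0_norm ?invr_ge0// => mid.
  have := hilbert_parallelogram HX (p n) (p m).
  have := dlim m.
  have : m.+1%:R^-1 <= n.+1%:R^-1 :> R by rewrite lef_pV2 ?posrE// ler_nat.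
  have : 2^-1 ^+ 2 = 4^-1 :> R by field.
  move: mid ln lm => + + + q; rewrite q.
  by move: (n.+1%:R^-1) (m.+1%:R^-1) (`|p n + p m| ^+ 2) => hn hm s; lra.
have pcvg : cvgn p.
  apply/cauchy_cvgP/cauchy_exP => e e0.
  have r0 : (fun n => 2 * (limn d - d n) + 4 * n.+1%:R^-1) @ \oo --> (0 : R).
    have -> : 0 = 2 * (limn d - limn d) + 4 * 0 :> R.
      by rewrite subrr !mulr0 addr0.
    apply: cvgD; apply: cvgMr.
      by apply: cvgB => //; exact: cvg_cst.
    exact: cvg_harmonic.
  have e20 : 0 < e ^+ 2 by rewrite exprn_gt0.
  have /cvgrPdist_lt/(_ _ e20) [N _ NP] := r0.
  exists (p N); exists N => // n /= Nn; rewrite -ball_normE /=.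
  have := NP N (leqnn N); rewrite sub0r normrN.
  move=> /(le_lt_trans (ler_norm _)) lt.
  have := le_lt_trans (dist _ _ Nn) lt.
  by rewrite ltr_pXn2r ?nnegrE// ltW.
exists (limn p) => n; apply: (@closed_cvg _ _ \oo _ p (C n)) => //.
by exists n => // m /= nm; exact: Cle nm _ (pP m).1.
Qed.
(** The half-space condition is only required frequently: each set [C n] below needs just one [u m],
    with [m] late enough that [T (u m)] is within [1/(n+1)] of [w]. Midpoints stay in [C n] because
    [T] and [f] are linear. *)
Lemma hilbert_weak_cluster (R : realType) (X : completeNormedModType R)
    (W : normedModType R) (T : {linear X -> W}) (f : X -> R^o)
    (u : nat -> X) (w : W) (M a : R) :
  hilbert X -> continuous T -> linear f -> continuous f ->
  (forall n, `|u n| <= M) -> (fun n => T (u n)) @ \oo --> w ->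
  (forall N, exists2 n, (N <= n)%N & a <= f (u n)) ->
  exists2 x, T x = w & a <= f x.
Proof.
move=> HX Tc fl fc uM uw fu.
pose C n := [set x : X | `|w - T x| <= n.+1%:R^-1] `&` [set x | a <= f x].
have [|||n|x Cx] := @hilbert_bigcap_nonempty _ _ C M HX.
- move=> n; apply: closedI.
    have gc : continuous (fun x => `|w - T x|).
      move=> x; apply: cvg_norm; apply: cvgB; [exact: cvg_cst | exact: Tc].
    exact: ((continuous_closedP _).1 gc _ (@closed_le _ _)).
  exact: ((continuous_closedP _).1 fc _ (@closed_ge _ _)).
- move=> n x y [/= wx ax] [/= wy ay]; split => /=.
    have -> : w - T (2^-1 *: (x + y)) = 2^-1 *: ((w - T x) + (w - T y)).
      rewrite linearZ linearD /= addrACA -opprD scalerBr.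
      rewrite -mulr2n -(scaler_nat 2 w).
      by rewrite scalerA mulVf ?scale1r.
    rewrite normrZ ger0_norm ?invr_ge0//.
    have := ler_normD (w - T x) (w - T y).
    by move: wx wy; move: (n.+1%:R^-1) => h; lra.
  have -> : f (2^-1 *: (x + y)) = 2^-1 *: (f x + f y).
    have f0 : f 0 = 0.
      by have := fl (-1) 0 0; rewrite scaler0 addr0 scaleN1r addNr.
    have fD z t : f (z + t) = f z + f t by have := fl 1 z t; rewrite !scale1r.
    by have := fl 2^-1 (x + y) 0; rewrite !addr0 f0 addr0 fD.
  by rewrite /GRing.scale /=; lra.
- move=> n x [/= wx ax]; split => //=; apply: le_trans wx _.
  by rewrite lef_pV2 ?posrE// ler_nat.
- have e0 : 0 < n.+1%:R^-1 :> R by rewrite invr_gt0.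
  have /cvgrPdist_le/(_ _ e0) [N _ NP] := uw.
  by have [m Nm am] := fu N; exists (u m); [split => //; exact: NP | exact: uM].
exists x; last exact: (Cx 0%N).2.
apply/esym/subr0_eq/normr0_eq0/eqP; rewrite eq_le normr_ge0 andbT.
apply/ler_addgt0Pr => e e0; rewrite add0r.
have [N _ NP] := (cvgrPdist_lt _ _).1 (@cvg_harmonic R) _ e0.
apply: le_trans (Cx N).1 _; have := NP N (leqnn N).
by rewrite sub0r normrN /harmonic/= => /(le_lt_trans (ler_norm _)) /ltW.
Qed.

Lemma weak_cvg_of_embedding_cvg (R : realType) (X : completeNormedModType R)
    (W : normedModType R) (T : {linear X -> W}) (u : nat -> X) (w : W) (M : R) :
  hilbert X -> continuous_embedding T ->
  (forall n, `|u n| <= M) -> (fun n => T (u n)) @ \oo --> w ->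
  exists2 x, T x = w & weak_cvg u x.
Proof.
move=> HX [Tinj Tc] uM uw.
(* With the zero functional and [a = 0] the half-space is everything, so only a preimage of [w] is
   obtained. *)
have [x Tx _] : exists2 x, T x = w & 0 <= (fun=> 0 : R^o) x.
  apply: (hilbert_weak_cluster HX Tc _ _ uM uw).
  - by move=> a y z; rewrite scaler0 addr0.
  - by move=> y; exact: cvg_cst.
  - by move=> N; exists N.
exists x => //; apply/weak_cvgP => f.
(* If [g (u n) >= g x + e] infinitely often, some [y] with [T y = w] would satisfy [g y >= g x + e];
   but [y = x] by injectivity. Using this for [f] and [- f] gives both halves of the convergence. *)
have upper (g : X -> R^o) : linear g -> continuous g -> forall e, 0 < e ->
    \forall n \near \oo, g (u n) < g x + e.
  move=> gl gc e e0; apply: contrapT => nnear.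
  have [|y Ty] := hilbert_weak_cluster (a := g x + e) HX Tc gl gc uM uw.
    move=> N; apply: contrapT => nex; apply: nnear; exists N => // n /= Nn.
    by rewrite ltNge; apply/negP => le; apply: nex; exists n.
  have -> : y = x by apply: Tinj; rewrite Ty.
  by rewrite gerDl leNgt e0.
have [fl fc] := svalP f.
apply/cvgrPdist_lt => e e0.
have ub := upper _ fl fc _ e0.
have lb : \forall n \near \oo, - f (u n) < - f x + e.
  apply: (upper (fun y => - f y)) => //.
    by move=> a y z /=; rewrite /dual_fun fl opprD scalerN.
  by move=> y; apply: cvgN; exact: fc.
near=> n.
have h1 : f (u n) < f x + e by near: n.
have h2 : - f (u n) < - f x + e by near: n.
by rewrite ltr_norml; apply/andP; split; lra.
Unshelve. all: by end_near. Qed.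

(** * Weak* compactness of bounded sets along ultrafilters *)

Lemma le_dual_norm (R : realType) (V : normedModType R) (f : dual V) (x : V) :
  `|f x| <= dual_norm f * `|x|.
Proof.
have [fl fc] := svalP f.
pose F : {linear V -> R^o} := HB.pack (dual_fun f)
  (GRing.isLinear.Build R V R^o *:%R (dual_fun f) fl).
(* This bound makes the set in [dual_norm] bounded above, so its [sup] is a true supremum and not
   the default value 0. *)
have [r r0 rP] : exists2 r : R, 0 < r & forall y, `|f y| <= r * `|y|.
  by have /linear_bounded_continuous/linear_boundedP/pinfty_ex_gt0 :
    continuous F := fc.
have f0 : f 0 = 0 := linear0 F.
have fZ a : f (a *: x) = a *: (f x : R^o) := linearZ_LR F a x.
have [->|x0] := eqVneq x 0; first by rewrite f0 !normr0 mulr0.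
have nx0 : 0 < `|x| by rewrite normr_gt0.
rewrite -ler_pdivrMr//.
have -> : `|f x| / `|x| = `|f (`|x|^-1 *: x)|.
  by rewrite fZ normrZ normfV normr_id mulrC.
apply: ub_le_sup.
  exists r => _ [y /= y1 <-]; apply: le_trans (rP y) _.
  by rewrite ler_piMr// ltW.
exists (`|x|^-1 *: x) => //=.
by rewrite normrZ normfV normr_id mulVf ?normr_eq0.
Qed.

Lemma ultra_compact_cvg (S : Type) (T : topologicalType) (U : set_system S)
    (f : S -> T) (K : set T) :
  UltraFilter U -> compact K -> (forall s, K (f s)) ->
  exists l : T, f @ U --> l.
Proof.
move=> UU Kc fK.
have UP := @ultra_proper _ _ UU.
have [G [GU fG]] := ultraFilterLemma (fmap_proper_filter f UP).
have GK : G K.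
  apply: fG; apply: (@filterS _ U _ setT); last exact: filterT.
  by move=> s _; exact: fK.
move: Kc; rewrite compact_ultra => /(_ G GU GK)[l [_ Gl]].
(* G only serves to produce l: U decides every preimage, so f @ U equals G. *)
exists l => A /Gl GA.
have [//|UnA] := in_ultra_setVsetC (f @^-1` A) UU.
have GnA : G (~` A) by apply: fG.
by have [y []] := filter_ex (filterI GA GnA).
Qed.

(** Each [D (y_ s) p] stays in the compact segment of radius [M * |p|], hence converges along [U].
    The pointwise limit inherits linearity and this bound, so it is a continuous functional, and
    surjectivity of [D] represents it by some [y]. *)
Lemma banach_alaoglu_ultra (R : realType) (P Y : normedModType R)
    (D : Y -> dual P) (S : Type) (U : set_system S) (y_ : S -> Y) (M : R) :
  is_dual D -> UltraFilter U -> (forall s, `|y_ s| <= M) ->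
  exists y, forall p, (fun s => D (y_ s) p) @ U --> D y p.
Proof.
move=> [_ Dsurj DE] UU yM.
have UP := @ultra_proper _ _ UU.
have Db s p : `|D (y_ s) p| <= M * `|p|.
  apply: le_trans (le_dual_norm _ _) _.
  by rewrite ler_wpM2r// -DE.
have /choice[f fP] : forall p, exists l : R, (fun s => D (y_ s) p) @ U --> l.
  move=> p; have K := @segment_compact R (- (M * `|p|)) (M * `|p|).
  apply: (ultra_compact_cvg UU K).
  by move=> s /=; rewrite in_itv/= -ler_norml.
have fl : linear (f : P -> R^o).
  move=> a p q.
  have h1 := fP (a *: p + q).
  have h2 : (fun s => a * D (y_ s) p + D (y_ s) q) @ U --> a * f p + f q.
    by apply: cvgD => //; apply: cvgM => //; exact: cvg_cst.
  apply: (norm_cvg_unique h1).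
  apply: cvg_trans h2; apply: near_eq_cvg; apply: nearW => s.
  by have [+ _] := svalP (D (y_ s)); rewrite /dual_fun => ->.
have fb p : `|f p| <= M * `|p|.
  apply: (@cvgr_to_le _ U _ _ (fun s => `|D (y_ s) p|)).
    by apply: cvg_norm; exact: fP.
  by apply: nearW => s; exact: Db.
pose F : {linear P -> R^o} := HB.pack (f : P -> R^o)
  (GRing.isLinear.Build R P R^o *:%R (f : P -> R^o) fl).
have fc : continuous (f : P -> R^o).
  apply: (@bounded_linear_continuous _ _ _ F).
  apply/linear_boundedP; near=> r => p; apply: le_trans (fb p) _.
  by rewrite ler_wpM2r//; near: r; apply: nbhs_pinfty_ge; rewrite num_real.
have [y yE] := Dsurj (exist _ f (conj fl fc)).
by exists y => p; rewrite yE; exact: fP.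
Unshelve. all: by end_near. Qed.

(** * Subsequences realizing limits along a filter *)

Lemma filter_subsequence (U : set_system nat) (A : nat -> set nat) :
  ProperFilter U -> \oo `<=` U -> (forall n, U (A n)) ->
  exists phi : nat -> nat, increasing_seq phi /\ forall n, A n (phi n).
Proof.
move=> UP ooU UA.
have /choice[h hP] : forall nN : nat * nat, exists m, (nN.2 < m)%N /\ A nN.1 m.
  move=> [n N]; have UN : U [set m | (N < m)%N] by apply: ooU; exists N.+1.
  by have [m [Nm Am]] := filter_ex (filterI UN (UA n)); exists m.
pose phi := fix phi n := if n is k.+1 then h (n, phi k) else h (0%N, 0%N).
exists phi; split; last by case=> [|n] /=; exact: (hP (_, _)).2.
by apply/increasing_seqP => n; exact: (hP (n.+1, phi n)).1.
Qed.

(** The [n]-th index is chosen so that the first [n] points of a dense sequence [q], and [w_], are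
    within [1/(n+1)] of their limits. Convergence thus holds on every [q k], and the uniform norm
    bound carries it to all of the predual. *)
Lemma separable_weak_star_subsequence (R : realType) (P Y W : normedModType R)
    (D : Y -> dual P) (U : set_system nat) (y_ : nat -> Y) (y : Y) (M : R)
    (w_ : nat -> W) (w : W) :
  separable P -> is_dual D -> ProperFilter U -> \oo `<=` U ->
  (forall n, `|y_ n| <= M) ->
  (forall p, (fun n => D (y_ n) p) @ U --> D y p) -> w_ @ U --> w ->
  exists phi : nat -> nat, [/\ increasing_seq phi,
    weak_star_cvg D (y_ \o phi) y & (w_ \o phi) @ \oo --> w].
Proof.
move=> [B cB dB] [_ _ DE] UP ooU yM yU wU.
have [q qB] : exists q : nat -> P, B `<=` range q.
  have /pfcard_geP[->|[g]] := cB; first by exists (fun=> 0).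
  exists g => p Bp; have [n _ <-] := @surj _ _ _ _ g p Bp; by exists n.
have e0 (n : nat) : 0 < n.+1%:R^-1 :> R by rewrite invr_gt0.
pose A n := [set m |
  (forall k : 'I_n, `|D y (q k) - D (y_ m) (q k)| < n.+1%:R^-1) /\
  `|w - w_ m| < n.+1%:R^-1].
have [n|phi [phiI phiA]] := filter_subsequence UP ooU (A := A).
  apply: filterI; last exact: (cvgrPdist_lt _ _).1 wU _ (e0 n).
  by apply: filter_forall => k; exact: (cvgrPdist_lt _ _).1 (yU _) _ (e0 n).
have small (e : R) : 0 < e -> \forall n \near \oo, n.+1%:R^-1 < e.
  move=> ep; have [N _ NP] := (cvgrPdist_lt _ _).1 (@cvg_harmonic R) _ ep.
  exists N => // n /NP; rewrite sub0r normrN; apply: le_lt_trans.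
  exact: ler_norm.
exists phi; split=> //; last first.
  apply/cvgrPdist_lt => e /small; apply: filterS => n; apply: lt_trans.
  exact: (phiA n).2.
apply/weak_star_cvgP => p; apply/cvgrPdist_lt => e ep.
have [K K0 [KM Ky]] : exists2 K : R, 0 < K &
    (forall n, `|y_ n| <= K) /\ `|y| <= K.
  exists (`|M| + `|y| + 1); first by rewrite ltr_wpDl// addr_ge0.
  split=> [n|]; last by rewrite addrAC ler_wpDl.
  rewrite -addrA ler_wpDr ?addr_ge0//.
  exact: le_trans (yM n) (ler_norm M).
have DB (z : Y) a b : `|D z a - D z b| <= `|z| * `|a - b|.
  have -> : D z a - D z b = D z (a - b).
    have [Dl _] := svalP (D z).
    by rewrite /dual_fun [a - b]addrC -[- b]scaleN1r Dl scaleN1r addrC.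
  by rewrite DE; exact: le_dual_norm.
(* Replacing [p] by a point [q k] within [d] costs at most [e / 4] for [y] and [e / 4] for
   [y_ (phi n)], leaving [e / 2] for the difference at [q k]. *)
pose d := e / (4 * K).
have d0 : 0 < d by rewrite divr_gt0// mulr_gt0.
have [x [pd /qB [k _ qk]]] : ball p d `&` B !=set0.
  by apply: dB; [exists p; exact: ballxx | exact: ball_open].
move: pd; rewrite -qk -ball_normE /= => pd.
have Kd (z : Y) : `|z| <= K -> `|D z p - D z (q k)| <= e / 4.
  move=> zK; apply: le_trans (DB _ _ _) _.
  have -> : e / 4 = K * d by rewrite /d; field; rewrite gt_eqF.
  by rewrite ler_pM// ltW.
near=> n.
(* From here on [q k] is among the points controlled by [A n]. *)
have kn : (k < n)%N by near: n; exists k.+1.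
have ne : n.+1%:R^-1 < e / 2 by near: n; apply: small; rewrite divr_gt0.
have h1 := Kd _ Ky.
have h2 := lt_trans ((phiA n).1 (Ordinal kn)) ne.
have h3 := Kd _ (KM (phi n)).
rewrite (_ : D y p - _ = (D y p - D y (q k))
  + (D y (q k) - D (y_ (phi n)) (q k))
  - (D (y_ (phi n)) p - D (y_ (phi n)) (q k))); last by rewrite /=; ring.
apply: le_lt_trans (ler_normB _ _) _.
apply: le_lt_trans (lerD (ler_normD _ _) (lexx _)) _.
by rewrite /= in h2 *; lra.
Unshelve. all: by end_near. Qed.

(** * Lower semicontinuity along sequences *)

Lemma limn_einf_le_near (R : realType) (u : nat -> \bar R) (b : \bar R) :
  (\forall n \near \oo, (u n <= b)%E) -> (limn_einf u <= b)%E.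
Proof.
move=> ub; rewrite limn_einf_lim; apply: lime_le; first exact: is_cvg_einfs.
apply: filterS ub => n; apply: le_trans.
by apply: ereal_inf_lbound; exists n => /=.
Qed.

Lemma weakly_lsc_near (R : realType) (V : normedModType R) (f : V -> R)
    (u : nat -> V) (x : V) (a : R) :
  weakly_lower_semicontinuous f -> weak_cvg u x -> a < f x ->
  \forall n \near \oo, a < f (u n).
Proof.
move=> fl ux ax; have [|B Bx Bf] := fl x a; first by rewrite lte_fin.
have uB : \forall n \near \oo, B (u n) := ux _ Bx.
by apply: filterS uB => n Bn; rewrite -lte_fin; exact: Bf.
Qed.

Lemma increasing_seq_ge (phi : nat -> nat) n :
  increasing_seq phi -> (n <= phi n)%N.
Proof.
move=> /increasing_seqP phiS; elim: n => // n /leq_ltn_trans; apply.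
exact: phiS.
Qed.

(** * Convergence of the minimizers and optimality of the limit *)

Theorem lemma2p8 (R : realType)
  (* X, W, Y, Z, and the predual P of Y *)
  (X W P : completeNormedModType R) (Y : normedModType R)
  (Z : completeNormedModType R)
  (iX : {linear X -> W}) (iY : {linear Y -> W}) (iZ : {linear Z -> Y})
  (D : Y -> dual P)
  (X_ : nat -> set (X * Z))
  (psi : R -> Y -> \bar R) (psi0 : Y -> \bar R) (eta : X -> R) (j : Y -> R)
  (beta : R)
  (P1_X : hilbert X) (P1_W : separable W) (P1_emb : compact_embedding iX)
  (P2_sep : separable P) (P2_dual : is_dual D)
  (P3 : continuous_embedding iY)
  (P4 : forall (v_ : nat -> X * Y) (vhat : X) (vbar : Y),
     (forall k, cap iX iY (v_ k)) ->
     weak_cvg (fun k => (v_ k).1) vhat ->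
     weak_star_cvg D (fun k => (v_ k).2) vbar ->
     iX vhat = iY vbar)
  (psi_gtNy : forall gamma v, 0 < gamma -> (-oo < psi gamma v)%E)
  (P5 : forall gamma, 0 < gamma -> weak_star_seq_lsc D (psi gamma))
  (P6 : weakly_lower_semicontinuous eta)
  (P7 : forall (v_ : nat -> Y) (v : Y),
     (fun k => iY (v_ k)) @ \oo --> iY v -> (fun k => j (v_ k)) @ \oo --> j v)
  (P8_j : exists m : R, forall v, cap iX iY v -> m <= j v.2)
  (P8_psi : forall gamma, 0 < gamma ->
     exists m : R, forall v, cap iX iY v -> (m%:E <= psi gamma v.2)%E)
  (P8_eta : exists m : R, forall v, cap iX iY v -> m <= eta v.1)
  (P9 : forall (gamma : R) (v_ : nat -> X * Y), 0 < gamma ->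
     (forall k, cap iX iY (v_ k)) ->
     (exists M : R, forall k,
        (`|psi gamma (v_ k).2 + (eta (v_ k).1)%:E| <= M%:E)%E) ->
     exists M : R, forall k, `|(v_ k).2| + `|(v_ k).1| <= M)
  (P10 : continuous_embedding iZ)
  (P11_sub : forall k, X_ k `<=` cap iX (iY \o iZ))
  (P11_lin : forall k, submod_closed [in X_ k])
  (P11_nondecr : forall k, X_ k `<=` X_ k.+1)
  (P11_dense : forall w, cap iX (iY \o iZ) w ->
     exists w_ : nat -> X * Z,
       [/\ forall k, X_ k (w_ k),
           (fun k => (w_ k).1) @ \oo --> w.1
         & exists M : R, forall k, `|(w_ k).2| <= M])
  (P12 : forall (gamma : R) (v_ : nat -> Z) (v : Z), 0 < gamma ->
     (exists M : R, forall k, `|v_ k| <= M) ->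
     (fun k => iY (iZ (v_ k))) @ \oo --> iY (iZ v) ->
     (fun k => psi gamma (iZ (v_ k))) @ \oo --> psi gamma (iZ v))
  (P13 : continuous eta)
  (P14 : forall (v : Y) (gamma gamma' : R), 0 < gamma -> gamma <= gamma' ->
     (psi gamma' v <= psi gamma v)%E)
  (P15_beta : 0 < beta)
  (P15_in : forall z : Z, psi0 (iZ z) = (beta * `|z|)%:E)
  (P15_out : forall v : Y, (forall z : Z, iZ z <> v) -> psi0 v = +oo%E)
  (P15_lim : forall v : Y, psi gamma v @[gamma --> 0^'+] --> psi0 v)
  (gamma_ : nat -> R) (gamma_gt0 : forall l, 0 < gamma_ l)
  (gamma_nonincr : nonincreasing_seq gamma_) (gamma_cvg : gamma_ @ \oo --> 0)
  (v_ : nat -> X * Y) (v_cap : forall l, cap iX iY (v_ l))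
  (v_min : forall l w, cap iX (iY \o iZ) w ->
     ((j (v_ l).2)%:E + psi (gamma_ l) (v_ l).2 + (eta (v_ l).1)%:E <=
      (j (iZ w.2))%:E + psi (gamma_ l) (iZ w.2) + (eta w.1)%:E)%E) :
  exists (phi : nat -> nat) (vbar : X * Z),
    [/\ increasing_seq phi,
        (fun n => iX (v_ (phi n)).1) @ \oo --> iX vbar.1,
        weak_cvg (fun n => (v_ (phi n)).1) vbar.1,
        weak_star_cvg D (fun n => (v_ (phi n)).2) (iZ vbar.2)
      & is_minimizer (cap iX (iY \o iZ))
          (fun v => j (iZ v.2) + beta * `|v.2| + eta v.1) vbar].
Proof.
have psi_le0 g v : 0 < g -> (psi g v <= psi0 v)%E.
  move=> g0; apply: cvge_to_ge (P15_lim v) _.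
  near=> h; apply: P14; first by near: h; exact: nbhs_right_gt.
  by near: h; exact: nbhs_right_le.
pose F (w : X * Z) := j (iZ w.2) + beta * `|w.2| + eta w.1.
(* On the right of [v_min], [psi (gamma_ l)] is replaced by its upper bound [beta * |w.2|]. The left
   value of [psi] is then real: [psi_gtNy] excludes [-oo], the finite right-hand side [+oo]. *)
have psi_le l w : cap iX (iY \o iZ) w ->
    (psi (gamma_ l) (v_ l).2 <= (F w - j (v_ l).2 - eta (v_ l).1)%:E)%E.
  move=> wc.
  have := le_trans (v_min l w wc)
    (leeD2r _ (leeD2l _ (psi_le0 _ _ (gamma_gt0 l)))).
  rewrite P15_in; have := psi_gtNy _ (v_ l).2 (gamma_gt0 l).
  case: (psi _ _) => [r||]//= _; rewrite -!EFinD !lee_fin /F; lra.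
have c0 : cap iX (iY \o iZ) (0, 0) by rewrite /cap /= !linear0.
have [mj mjP] := P8_j; have [me meP] := P8_eta.
have [mp mpP] := P8_psi _ (gamma_gt0 0%N).
have [M MP] : exists M : R, forall k, `|(v_ k).2| + `|(v_ k).1| <= M.
  apply: (P9 (gamma_ 0%N)) => //.
  (* [gamma_ 0] is the largest parameter, so by [P14] its [psi] inherits the upper bound of
     [psi_le]. The sum in [P9] lies between [mp + me] and [F (0, 0) - mj]. *)
  exists (`|mp + me| + `|F (0, 0) - mj|) => l.
  have h1 := mjP _ (v_cap l); have h2 := meP _ (v_cap l).
  have := mpP _ (v_cap l).
  have := le_trans (P14 (v_ l).2 _ _ (gamma_gt0 l)
    (gamma_nonincr _ _ (leq0n l))) (psi_le l _ c0).
  case: (psi _ _) => [r||]//=; rewrite !lee_fin => h3 h4.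
  have h5 := ler_norm (F (0, 0) - mj); have h6 := lerNnormlW (lexx `|mp + me|).
  have h7 := normr_ge0 (F (0, 0) - mj); have h8 := normr_ge0 (mp + me).
  by rewrite ler_norml; apply/andP; split; lra.
have MX l : `|(v_ l).1| <= M by apply: le_trans (MP l); rewrite lerDr.
have MY l : `|(v_ l).2| <= M by apply: le_trans (MP l); rewrite lerDl.
(* One ultrafilter containing all tails serves for both limits, so a common subsequence can realize
   them. *)
have [U [UU ooU]] := ultraFilterLemma (eventually_filter).
have [w wU] : exists w : W, (fun l => iX (v_ l).1) @ U --> w.
  have bnd : bounded_set (range (fun l => (v_ l).1)).
    exists M; split; first exact: num_real.
    by move=> r Mr _ [l _ <-]; exact: le_trans (MX l) (ltW Mr).
  have := P1_emb.2 _ bnd; rewrite precompactE => cK.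
  apply: (ultra_compact_cvg UU cK) => l.
  by apply: subset_closure; exists (v_ l).1 => //; exists l.
have [y yU] := banach_alaoglu_ultra P2_dual UU MY.
have [phi [phiI phiY phiW]] := separable_weak_star_subsequence P2_sep P2_dual
  (@ultra_proper _ _ UU) ooU MY yU wU.
have [x xw phiX] := weak_cvg_of_embedding_cvg P1_X P1_emb.1
  (fun n => MX (phi n)) phiW.
have xy : iX x = iY y := P4 (v_ \o phi) x y (fun k => v_cap (phi k)) phiX phiY.
have jcvg : (fun k => j (v_ (phi k)).2) @ \oo --> j y.
  apply: P7; rewrite -xy xw; apply: cvg_trans phiW.
  by apply: near_eq_cvg; apply: nearW => n /=; exact: v_cap.
(* Semicontinuity concerns one fixed [psi g], whereas [psi_le] has the moving parameter
   [gamma_ (phi n)]; once this is below [g], [P14] compares the two. The error [e] is shared equally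
   by [j] and [eta]. *)
have psi_y g u : 0 < g -> cap iX (iY \o iZ) u ->
    (psi g y <= (F u - j y - eta x)%:E)%E.
  move=> g0 uc; apply/lee_addgt0Pr => e e0.
  apply: le_trans (P5 _ g0 _ _ phiY) _; apply: limn_einf_le_near.
  have e20 : 0 < e / 2 by rewrite divr_gt0.
  near=> n.
  have gn : gamma_ (phi n) <= g.
    apply: le_trans (gamma_nonincr _ _ (increasing_seq_ge n phiI)) _.
    by near: n; apply: (cvgr_le _ gamma_cvg).
  have jn : j y - e / 2 < j (v_ (phi n)).2.
    by near: n; apply: (cvgr_gt _ jcvg); rewrite gtrBl.
  have en : eta x - e / 2 < eta (v_ (phi n)).1.
    by near: n; apply: (weakly_lsc_near P6 phiX); rewrite gtrBl.
  apply: le_trans (P14 _ _ _ (gamma_gt0 (phi n)) gn) _.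
  apply: le_trans (psi_le _ _ uc) _.
  by rewrite -EFinD lee_fin; lra.
have psi0_y u : cap iX (iY \o iZ) u -> (psi0 y <= (F u - j y - eta x)%:E)%E.
  move=> uc; apply: cvge_to_le (P15_lim y) _.
  by near=> g; apply: psi_y => //; near: g; exact: nbhs_right_gt.
(* Testing with the origin bounds [psi0 y] by a real number, whereas outside the image of [Z] it
   would be [+oo]. *)
have [z zy] : exists z, iZ z = y.
  apply: contrapT => nz; have := psi0_y _ c0.
  by rewrite P15_out// => z zy; apply: nz; exists z.
exists phi, (x, z); split => //=.
- by rewrite xw.
- by rewrite zy.
- split; first by rewrite /cap /= zy.
  by move=> u /psi0_y; rewrite -zy P15_in lee_fin /F /=; lra.
Unshelve. all: by end_near. Qed.
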